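(* Let $n$ be a positive integer and, for $p\in(0,1]$, let $B_{n,p}$ denote a binomial random variable with parameters $n$ and $p$. Then for every real $y>0$, $$\inf_{0<p\le 1}\mathbf{P}\left(|B_{n,p}-\mathbf{E}[B_{n,p}]|\ge y\sqrt{\mathrm{Var}(B_{n,p})}\right)=0.$$
   Context: $\mathbf{P}$, $\mathbf{E}$ and $\mathrm{Var}$ denote probability, expectation and variance. The binomial distribution with parameters $n$ and $p$ is that of the number of successes in $n$ independent trials each with success probability $p$. *)

(* Defs.v *)
From HB Require Import structures.
From mathcomp Require Import all_boot all_order all_algebra.
From mathcomp Require Import all_classical all_reals all_analysis.

Set Implicit Arguments.
Unset Strict Implicit.
Unset Printing Implicit Defensive.

Import Order.TTheory GRing.Theory Num.Theory.

Local Open Scope classical_set_scope.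
Local Open Scope ring_scope.

(* [binomial_prob n p] is a probability measure on [nat]; a real-valued random
   variable is binomial when its law is the image of [binomial_prob n p] under
   the embedding of [nat] in [R]. *)
Definition binomial_rv (R : realType) (d : measure_display)
    (T : measurableType d) (P : probability T R) (X : {RV P >-> R})
    (n : nat) (p : R) : Prop :=
  forall A : set R, measurable A ->
    distribution P X A = binomial_prob n p [set k : nat | A k%:R].

Lemma binomial_rv_exists (R : realType) (n : nat) (p : R) :
  exists X : {RV (binomial_prob n p : probability nat R) >-> R},
    binomial_rv X n p.
Proof.
have mX : measurable_fun [set: nat] (fun k : nat => k%:R : R) by [].
exists (mfun_Sub (mem_set mX : (fun k : nat => k%:R : R) \in mfun)).
by move=> A _.
Qed.

(* Main.v *)
Require Import Defs.
From HB Require Import structures.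
From mathcomp Require Import all_boot all_order all_algebra.
From mathcomp Require Import all_classical all_reals all_analysis.
From mathcomp Require Import measurable_realfun ring lra.

Set Implicit Arguments.
Unset Strict Implicit.
Unset Printing Implicit Defensive.

Import Order.TTheory GRing.Theory Num.Theory.

Local Open Scope classical_set_scope.
Local Open Scope ring_scope.

(** As [p] tends to [0], the binomial variable [X] almost always vanishes, and
    the point is that the value [0] does not count as a deviation.  Put
    [q = P (X != 0)].  Outside [0] the variable lies in [[1, n]], so its mean
    is at most [n q], of order [q], while its variance is at least of order [q]
    and its standard deviation at least of order [sqrt q].  Hence the distance
    [`|0 - E X|] is smaller than [y] standard deviations as soon as [q] is
    small enough in terms of [n] and [y]: the deviation event is then contained
    in [X != 0] and has probability at most [q] ([deviation_prob_le]).  Since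
    [q = 1 - (1 - p) ^ n] is positive and at most [n p], it can be made
    arbitrarily small.

    The binomial law enters through its mass at [0] and the range of its nonzero
    values; the bounds on the first two moments follow from these alone. *)

Lemma neq0_preimage (U : Type) (R : nzRingType) (f : U -> R) :
  [set w | f w != 0] = f @^-1` (~` [set 0]).
Proof. by apply/seteqP; split => w /=; [move/eqP|move=> h; apply/eqP]. Qed.

Section rare_variable.
Context (R : realType) (d : measure_display) (T : measurableType d).
Context (P : probability T R) (X : {RV P >-> R}) (M q : R).

Let S : set T := [set w | X w != 0].

Context (PS : P S = q%:E).
Context (XM : {ae P, forall w, X w != 0 -> 1 <= `|X w| <= M}).

Lemma measurable_support : measurable S.
Proof.
rewrite /S neq0_preimage.
by apply: measurable_funPTI; exact: measurableC.
Qed.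

Let q_ge0 : 0 <= q.
Proof. by rewrite -lee_fin -PS. Qed.

Let integral_support (c : R) : 0 <= c ->
  (\int[P]_w (c * \1_S w)%:E = (c * q)%:E)%E.
Proof.
move=> c0; under eq_integral do rewrite EFinM.
rewrite ge0_integralZl_EFin//.
- rewrite integral_indic//; last exact: measurable_support.
  by rewrite setIT EFinM -PS.
- by apply/measurable_EFinP; apply: measurable_indic; exact: measurable_support.
Qed.

(** Integrate [`|X| <= M * \1_S]. *)
Lemma expectation_bound : 0 <= M ->
  exists2 m : R, ('E_P[X] = m%:E)%E & `|m| <= M * q.
Proof.
move=> M0.
have mX : measurable_fun [set: T] (EFin \o X) by exact/measurable_EFinP.
have E_le : (`|'E_P[X]| <= (M * q)%:E)%E.
  rewrite unlock -integral_support//.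
  apply: (le_trans (le_abse_integral P measurableT mX)).
  apply: ae_ge0_le_integral => //.
  - exact: measurableT_comp.
  - by move=> w _; rewrite lee_fin mulr_ge0.
  - apply/measurable_EFinP; apply: measurable_funM => //.
    by apply: measurable_indic; exact: measurable_support.
  - apply: filterS XM => w XMw _ /=; rewrite lee_fin indicE.
    have [->|Xw0] := eqVneq (X w) 0; first by rewrite normr0 mulr_ge0.
    by rewrite mem_set//= mulr1; have /andP[] := XMw Xw0.
case: ('E_P[X])%E E_le => [m| |]; rewrite /= ?leye_eq// lee_fin => mM.
by exists m.
Qed.

(** On [S] the distance from [X] to its mean is at least [1 - 2^-1], which
    gives the lower bound.  The finiteness of the variance, part of the
    conclusion, matters because [fine] maps an infinite variance to [0]. *)
Lemma variance_bound (m : R) : ('E_P[X] = m%:E)%E -> `|m| <= 2^-1 ->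
  exists2 v : R, ('V_P[X] = v%:E)%E & 4^-1 * q <= v.
Proof.
move=> EX m_le.
have VE : ('V_P[X] = \int[P]_w ((X w - m) ^+ 2)%:E)%E.
  rewrite /variance covariance.unlock EX expectation.unlock.
  by apply: eq_integral => w _; rewrite expr2.
have mV : measurable_fun [set: T] (fun w => ((X w - m) ^+ 2)%:E).
  apply/measurable_EFinP; apply: measurable_funX.
  exact: measurable_funB.
have lowV : ((4^-1 * q)%:E <= 'V_P[X])%E.
  rewrite VE -integral_support//; apply: ae_ge0_le_integral => //.
  - apply/measurable_EFinP; apply: measurable_funM => //.
    by apply: measurable_indic; exact: measurable_support.
  - by move=> w _; rewrite lee_fin sqr_ge0.
  - apply: filterS XM => w XMw _ /=; rewrite lee_fin indicE.
    have [Xw0|Xw0] := eqVneq (X w) 0.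
      by rewrite memNset ?mulr0 ?sqr_ge0// /S/= Xw0 eqxx.
    rewrite mem_set//= mulr1; have /andP[X1 _] := XMw Xw0.
    rewrite -real_normK ?num_real//.
    have := lerB_dist (X w) m; nra.
(* A crude bound, only meant to exclude an infinite variance. *)
have upV : ('V_P[X] <= ((`|M| + 1) ^+ 2)%:E)%E.
  have -> : ((`|M| + 1) ^+ 2)%:E = (\int[P]_w ((`|M| + 1) ^+ 2)%:E)%E.
    by rewrite integral_cst// [X in (_ * X)%E]probability_setT mule1.
  rewrite VE; apply: ae_ge0_le_integral => //.
  - by move=> w _; rewrite lee_fin sqr_ge0.
  - apply: filterS XM => w XMw _ /=; rewrite lee_fin.
    rewrite -(real_normK (num_real (X w - m))).
    apply: lerXn2r; rewrite ?nnegrE ?addr_ge0//.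
    have XM' : `|X w| <= `|M|.
      have [->|Xw0] := eqVneq (X w) 0; first by rewrite normr0.
      by have /andP[_ /le_trans->//] := XMw Xw0; exact: ler_norm.
    by have := ler_normB (X w) m; lra.
case: ('V_P[X])%E lowV upV => [v| |]; rewrite /= ?leye_eq// lee_fin => v_ge _.
by exists v.
Qed.

(** The bound on [M * q] keeps the mean within [2^-1] of [0], so that
    [variance_bound] applies; the bound on [M ^+ 2 * q] then places [0] less
    than [y] standard deviations away from the mean:
    [`|E X| ^ 2 <= (M q) ^ 2 < y ^ 2 * q / 4 <= y ^ 2 * V X]. *)
Lemma deviation_prob_le (y : R) : 0 < y -> 0 < q -> 0 <= M ->
  M * q <= 2^-1 -> M ^+ 2 * q < y ^+ 2 / 4 ->
  (P [set w | (`|X w - fine 'E_P[X]| >= y * Num.sqrt (fine 'V_P[X]))%R]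
    <= q%:E)%E.
Proof.
move=> y0 q0 M0 Mq MMq.
have [m EX m_le] := expectation_bound M0.
have [v VX v_ge] := variance_bound EX (le_trans m_le Mq).
have mv : `|m| < y * Num.sqrt v.
  have v0 : 0 <= v by nra.
  rewrite -(@ltr_pXn2r _ 2)// ?nnegrE ?mulr_ge0 ?sqrtr_ge0 ?(ltW y0)//.
  rewrite exprMn sqr_sqrtr//.
  apply: (@le_lt_trans _ _ ((M * q) ^+ 2)).
    by apply: lerXn2r => //; rewrite nnegrE ?mulr_ge0.
  apply: (@lt_le_trans _ _ (y ^+ 2 * (4^-1 * q))); first nra.
  by apply: ler_wpM2l => //; exact: sqr_ge0.
rewrite EX VX /= -PS; apply: le_measure; rewrite ?inE.
- rewrite -[X in measurable X]setTI; apply: measurable_fun_le => //.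
  by apply: measurableT_comp => //; exact: measurable_funB.
- exact: measurable_support.
move=> w /=; apply: contraTneq => ->.
by rewrite sub0r normrN -ltNge.
Qed.

End rare_variable.

Lemma bernoulli_inequality (R : realDomainType) (p : R) (n : nat) : 0 <= p <= 1 ->
  1 - n%:R * p <= (1 - p) ^+ n.
Proof.
move=> p01; elim: n => [|n IH]; first by rewrite mul0r subr0 expr0.
rewrite exprS -natr1; have : (0 : R) <= n%:R by [].
move: IH; set a := _ ^+ n; set b := n%:R; nra.
Qed.

Section binomial_variable.
Context (R : realType) (d : measure_display) (T : measurableType d).
Context (P : probability T R) (X : {RV P >-> R}) (n : nat) (p : R).
Context (X_binomial : binomial_rv X n p) (p01 : 0 <= p <= 1).

Lemma binomial_prob_neq0 : P [set w | X w != 0] = (1 - (1 - p) ^+ n)%:E.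
Proof.
rewrite neq0_preimage -[LHS]/(distribution P X _) X_binomial; last exact: measurableC.
rewrite (_ : [set k : nat | _] = ~` [set 0%N]); last first.
  apply/seteqP; split => k /=; apply: contra_not => /eqP.
    by move/eqP->.
  by rewrite pnatr_eq0 => /eqP.
rewrite probability_setC//= /binomial_prob p01 esum_set1 ?lee_fin ?binomial_pmf_ge0//.
by rewrite /binomial_pmf expr0 mul1r subn0 bin0 mulr1n.
Qed.

Lemma binomial_ae_range :
  {ae P, forall w, X w != 0 -> 1 <= `|X w| <= n%:R}.
Proof.
pose A : set R := ~` ([set 0] `|` `[1, n%:R]).
have mA : measurable A by apply: measurableC; exact: measurableU.
exists (X @^-1` A); split.
- exact: measurable_funPTI.
- rewrite -[LHS]/(distribution P X A) X_binomial//= /binomial_prob p01.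
  apply: esum1 => k /= Ak; rewrite /binomial_pmf bin_small ?mulr0n//.
  rewrite ltnNge; apply/negP => kn; apply: Ak.
  case: k kn => [|k] kn; first by left.
  by right; rewrite /= in_itv/= ler_nat kn ler1n.
move=> w /= notXw [Xw0|]; first by apply: notXw; rewrite Xw0 eqxx.
rewrite /= in_itv/= => /andP[X1 Xn]; apply: notXw => _.
by rewrite ger0_norm ?X1 ?Xn// (le_trans _ X1).
Qed.

End binomial_variable.

Theorem proposition3p1 (R : realType) (n : nat) (n_gt0 : (0 < n)%N)
    (d : R -> measure_display) (T : forall p : R, measurableType (d p))
    (P : forall p : R, probability (T p) R)
    (B : forall p : R, {RV (P p) >-> R})
    (B_binomial : forall p : R, 0 < p <= 1 -> binomial_rv (B p) n p)
    (y : R) (y_gt0 : 0 < y) :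
  ereal_inf
    [set P p [set w | `|B p w - fine 'E_(P p)[B p]|
                        >= y * Num.sqrt (fine 'V_(P p)[B p])]
    | p in [set p : R | 0 < p <= 1]] = 0%E.
Proof.
apply/eqP; rewrite eq_le; apply/andP; split; last first.
  by apply/ereal_infP => _ [p _ <-]; exact: measure_ge0.
apply/lee_addgt0Pr => e e0; rewrite add0e.
have y2 : 0 < y ^+ 2 by exact: exprn_gt0.
(* [c] will bound [n ^ 2 q]: the three terms of the minimum serve the condition
   [n q <= 1/2], the target [q <= e] and the condition [n ^ 2 q < y ^ 2 / 4]. *)
pose c := Num.min 2^-1 (Num.min e (y ^+ 2 / 8)).
have c0 : 0 < c by rewrite !lt_min; apply/and3P; split; lra.
have [c_half c_e c_y] : [/\ c <= 2^-1, c <= e & c <= y ^+ 2 / 8].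
  by split; rewrite !ge_min lexx ?orbT.
have n1 : 1 <= n%:R :> R by rewrite ler1n.
have n0 : 0 < n%:R :> R by rewrite ltr0n.
(* Since [q <= n p], this choice yields [n ^ 2 q <= c]. *)
pose p := c / n%:R ^+ 3.
have p0 : 0 < p by rewrite divr_gt0// exprn_gt0.
have p1 : p <= 1.
  rewrite ler_pdivrMr ?exprn_gt0// mul1r (le_trans c_half)//.
  by rewrite (@le_trans _ _ 1)// ?exprn_ege1//; lra.
have p01 : 0 <= p <= 1 by rewrite ltW.
have p01' : 0 < p <= 1 by rewrite p0.
set q := 1 - (1 - p) ^+ n.
have q0 : 0 < q by rewrite subr_gt0 exprn_ilt1 ?lt0n_neq0//; lra.
have n2q : n%:R ^+ 2 * q <= c.
  have := bernoulli_inequality n p01; rewrite -/q => /= qnp.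
  have -> : c = n%:R ^+ 2 * (n%:R * p).
    by rewrite /p; field; rewrite gt_eqF.
  by rewrite ler_wpM2l ?sqr_ge0// /q; lra.
have nq_le : n%:R * q <= n%:R ^+ 2 * q.
  by rewrite expr2 -mulrA ler_peMl// mulr_ge0// ltW.
have q_le : q <= n%:R * q by rewrite ler_peMl// ltW.
apply: ge_ereal_inf; eexists; first by exists p.
apply: (@le_trans _ _ q%:E); last by rewrite lee_fin; lra.
apply: (deviation_prob_le (M := n%:R)) => //.
- exact: (binomial_prob_neq0 (B_binomial p p01') p01).
- exact: (binomial_ae_range (B_binomial p p01') p01).
- lra.
- lra.
Qed.
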